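(* Let $B\in\mathbb{C}$ and consider the rational difference equation $$z_{n+1}=\frac{z_{n}^{2}+Bz_{n}-Bz_{n-1}}{z_{n-1}},\quad n=0,1,\dots,$$ with initial conditions $z_{0},z_{-1}\in\mathbb{C}$. Then its forbidden set $\mathfrak{F}$ (a set of pairs $(z_0,z_{-1})$) equals $$S_{3}=\bigcup_{c\in\mathbb{C}\setminus\{0,1\}}\left\{\left(\frac{B-Bc^{n}}{c^{n}-c^{n+1}},\frac{B-Bc^{n+1}}{c^{n+1}-c^{n+2}}\right)\,\middle|\,n\in\mathbb{N}\right\}\cup\left(\{0\}\times\mathbb{C}\right)\cup\left(\mathbb{C}\times\{0\}\right)\cup\left\{(nB,nB+B)\,\middle|\,n\in\mathbb{N}\right\}.$$ Moreover, given $(z_{0},z_{-1})\notin\mathfrak{F}$, one has $z_{n+1}=Cz_{n}-B$ for all $n\geq 0$, where $C=\frac{z_{0}+B}{z_{-1}}$. This implies $$z_{n}=C^{n}z_{0}-\sum_{k=1}^{n}C^{k-1}B,\quad n\geq 1.$$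
   Context: The forbidden set $\mathfrak{F}$ of a second order rational difference equation is the set of initial conditions, written as pairs $(z_{0},z_{-1})\in\mathbb{C}^{2}$ in this order, for which the iteration eventually requires a division by zero (so that $z_n$ is not well defined for some $n\ge 1$; $0/0$ counts as undefined). $\mathbb{N}=\{1,2,3,\dots\}$, and $0^0=1$. *)

(* Defs.v *)
From mathcomp Require Import all_boot all_order all_algebra.
From mathcomp Require Import boolp classical_sets reals complex.

Set Implicit Arguments.
Unset Strict Implicit.
Unset Printing Implicit Defensive.
Import GRing.Theory.
Local Open Scope classical_set_scope.
Local Open Scope ring_scope.

Section SecondOrder.
Variables (K : fieldType) (num den : K -> K -> K).

(* The equation z_{n+1} = num z_n z_{n-1} / den z_n z_{n-1}; a state is the
   pair (z_n, z_{n-1}).  Since x / 0 = 0 in a fieldType, division by zero is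
   recorded by None, also when the numerator vanishes. *)
Definition next_state (s : K * K) : option (K * K) :=
  if den s.1 s.2 == 0 then None else Some (num s.1 s.2 / den s.1 s.2, s.1).

Definition state (s0 : K * K) (n : nat) : option (K * K) :=
  iter n (obind next_state) (Some s0).

(* z_n, for n >= 0, from the initial pair s0 = (z_0, z_{-1}) *)
Definition iterate (s0 : K * K) (n : nat) : option K := omap fst (state s0 n).

Definition forbidden_set : set (K * K) :=
  [set s0 | exists2 n : nat, (1 <= n)%N & iterate s0 n = None].

End SecondOrder.

Definition S3 (K : fieldType) (B : K) : set (K * K) :=
  \bigcup_(c in ~` [set 0; 1])
    [set ((B - B * c ^+ n) / (c ^+ n - c ^+ n.+1),
          (B - B * c ^+ n.+1) / (c ^+ n.+1 - c ^+ n.+2))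
       | n in [set n : nat | (1 <= n)%N]]
  `|` ([set 0] `*` setT)
  `|` (setT `*` [set 0])
  `|` [set (n%:R * B, n%:R * B + B) | n in [set n : nat | (1 <= n)%N]].

(* Main.v *)
Require Import Defs.
From mathcomp Require Import all_boot all_order all_algebra.
From mathcomp Require Import boolp classical_sets reals complex.
From mathcomp Require Import ring.

(** The quantity [C = (z_n + B) / z_{n-1}] is invariant under the recurrence:
    [z_{n+1} = z_n (z_n + B) / z_{n-1} - B = C z_n - B].  Hence, as long as it
    is defined, the second order equation follows the affine map
    [z |-> C z - B], and because [z_0 = C z_{-1} - B] the whole orbit,
    [z_{-1}] included, is the affine orbit of [z_{-1}].  The only denominators
    are the terms of this orbit, so a pair with [C z_{-1} = z_0 + B] is
    forbidden exactly when the affine orbit of [z_{-1}] vanishes somewhere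
    ([forbiddenP]).

    The set [S3] comes from solving [z_n = 0] explicitly.  Vanishing of
    [z_{-1}] or [z_0] gives the two coordinate axes.  For [n >= 1] the closed
    form of the affine orbit determines [z_0] from [C] and [n], and then
    [z_{-1} = (z_0 + B) / C]: the value [C = 1] gives the pairs
    [(nB, nB + B)], the values [C <> 0, 1] give the union over [c = C]
    ([affine_orbit_eq0]), and [C = 0] gives nothing new because the orbit is
    then constant from [z_0] on ([affine_orbit0]).  All of this holds over any
    field. *)

Set Implicit Arguments.
Unset Strict Implicit.
Unset Printing Implicit Defensive.
Import GRing.Theory.
Local Open Scope classical_set_scope.
Local Open Scope ring_scope.

Section AffineReduction.
Variables (K : fieldType) (B : K).
Implicit Types (c x y : K) (n : nat).

Definition quad_num x y := x ^+ 2 + B * x - B * y.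
Definition quad_den x y : K := y.

Local Notation forbidden := (forbidden_set quad_num quad_den).

Definition affine_orbit c x n := iter n (fun z => c * z - B) x.

Lemma affine_orbitS c x n :
  affine_orbit c x n.+1 = c * affine_orbit c x n - B.
Proof. by []. Qed.

Lemma affine_orbitSr c x n :
  affine_orbit c x n.+1 = affine_orbit c (c * x - B) n.
Proof. exact: iterSr. Qed.

Lemma affine_orbit_sum c x n :
  affine_orbit c x n = c ^+ n * x - \sum_(1 <= k < n.+1) c ^+ k.-1 * B.
Proof.
elim: n => [|n IHn]; first by rewrite big_nil expr0 mul1r subr0.
rewrite affine_orbitS IHn [in RHS]big_nat_recl //= expr0 mul1r.
under [in RHS]eq_big_nat => k /andP[k_gt0 _].
  rewrite -[in c ^+ k](prednK k_gt0) exprS -mulrA; over.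
by rewrite -big_distrr /= exprS; ring.
Qed.

(** Summing the geometric series after multiplication by [1 - c] keeps the
    identity valid at [c = 1]. *)
Lemma affine_orbit_geom c x n :
  (1 - c) * affine_orbit c x n = x * (c ^+ n - c ^+ n.+1) - (B - B * c ^+ n).
Proof.
elim: n => [|n IHn]; first by rewrite expr0 expr1 /=; ring.
rewrite affine_orbitS mulrBr mulrCA IHn !exprS; ring.
Qed.

Lemma affine_orbit1 x n : affine_orbit 1 x n = x - n%:R * B.
Proof.
elim: n => [|n IHn]; first by rewrite mul0r subr0.
by rewrite affine_orbitS IHn -natr1; ring.
Qed.

Lemma affine_orbit0 n : affine_orbit 0 (- B) n = - B.
Proof. by case: n => [|n] //; rewrite affine_orbitS mul0r sub0r. Qed.

Lemma expr_sub_neq0 c n : c != 0 -> c != 1 -> c ^+ n - c ^+ n.+1 != 0.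
Proof.
move=> c0 c1; rewrite exprSr -{1}[c ^+ n]mulr1 -mulrBr mulf_neq0 ?expf_neq0 //.
by rewrite subr_eq0 eq_sym.
Qed.

Lemma affine_orbit_eq0 c x n : c != 0 -> c != 1 ->
  affine_orbit c x n = 0 <-> x = (B - B * c ^+ n) / (c ^+ n - c ^+ n.+1).
Proof.
move=> c0 c1; have d0 := expr_sub_neq0 n c0 c1.
have e0 : 1 - c != 0 by rewrite subr_eq0 eq_sym.
split=> [w0|->].
  apply/(canRL (mulfK d0))/eqP.
  by rewrite -subr_eq0 -affine_orbit_geom w0 mulr0.
apply/(mulfI e0).
by rewrite mulr0 affine_orbit_geom divfK // subrr.
Qed.

(** The first coordinate is determined by [affine_orbit_eq0]; the second one is
    its image under [z |-> (z + B) / c], the inverse of the affine map, which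
    merely shifts the index [n]. *)
Lemma forbidden_pair_step c n : c != 0 -> c != 1 ->
  c * ((B - B * c ^+ n.+1) / (c ^+ n.+1 - c ^+ n.+2)) =
  (B - B * c ^+ n) / (c ^+ n - c ^+ n.+1) + B.
Proof.
move=> c0 c1; have d0 := expr_sub_neq0 n c0 c1.
have -> : c ^+ n.+1 - c ^+ n.+2 = c * (c ^+ n - c ^+ n.+1).
  by rewrite mulrBr -!exprS.
rewrite exprS in d0 *.
by field; rewrite d0 c0.
Qed.

(** The invariance of [C]: the hypothesis is reproduced by the conclusion for
    the next pair, since [c * x = (c * x - B) + B]. *)
Lemma next_state_affine c x y : c * y = x + B ->
  next_state quad_num quad_den (x, y) =
  if y == 0 then None else Some (c * x - B, x).
Proof.
rewrite /next_state /quad_den /quad_num /=.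
case: eqVneq => // y0 cy; congr (Some (_, _)).
have -> : c = (x + B) / y by rewrite -cy mulfK.
by field.
Qed.

(** A single product records all the denominators met during the first [n]
    steps. *)
Lemma state_affine c x y n : c * y = x + B ->
  state quad_num quad_den (x, y) n =
  if \prod_(k < n) affine_orbit c y k == 0 then None
  else Some (affine_orbit c y n.+1, affine_orbit c y n).
Proof.
move=> cy; elim: n => [|n IHn].
  by rewrite big_ord0 oner_eq0 /state /= cy addrK.
rewrite /state iterS -/(state _ _ _ _) IHn big_ord_recr mulf_eq0.
case: eqP => //= _; rewrite (next_state_affine (c := c)) //.
by rewrite subrK.
Qed.

Lemma iterate_affine c x y n : c * y = x + B ->
  (forall k, affine_orbit c y k != 0) ->
  iterate quad_num quad_den (x, y) n = Some (affine_orbit c x n).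
Proof.
move=> cy w0; rewrite /iterate (state_affine n cy) ifN /=.
  by rewrite -affine_orbitS affine_orbitSr cy addrK.
by apply/prodf_neq0 => k _.
Qed.

Lemma forbiddenP c x y : c * y = x + B ->
  forbidden (x, y) <-> exists k, affine_orbit c y k = 0.
Proof.
move=> cy; split=> [[n _]|[k wk]].
  rewrite /iterate (state_affine n cy); case: ifP => // /prodf_eq0[k _ /eqP wk].
  by exists (k : nat).
exists k.+1 => //; rewrite /iterate (state_affine _ cy) big_ord_recr /= wk.
by rewrite mulr0 eqxx.
Qed.

Lemma forbidden_affine c x y n : c * y = x + B ->
  affine_orbit c x n = 0 -> forbidden (x, y).
Proof.
move=> cy xn; apply/(forbiddenP cy); exists n.+1.
by rewrite affine_orbitSr cy addrK.
Qed.

Lemma forbidden_snd0 x : forbidden (x, 0).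
Proof. by exists 1 => //; rewrite /iterate /state /next_state /= eqxx. Qed.

Lemma forbidden_setE : forbidden = S3 B.
Proof.
apply/seteqP; split=> -[x y] /=.
- have [-> _|y0] := eqVneq y 0; first by left; right.
  have [-> _|x0] := eqVneq x 0; first by left; left; right.
  pose c := (x + B) / y; have cy : c * y = x + B by rewrite divfK.
  case/(forbiddenP cy) => -[/eqP|n]; first by rewrite (negPf y0).
  rewrite affine_orbitSr cy addrK => xn.
  have n_gt0 : (1 <= n)%N by case: n xn => // /eqP; rewrite (negPf x0).
  have [c0|c0] := eqVneq c 0.
    (* the orbit is constant from [x] on, so it vanishes only if [x] does *)
    have xB : x = - B by apply/eqP; rewrite -addr_eq0 -cy c0 mul0r.
    by move: xn; rewrite c0 xB affine_orbit0 -xB => /eqP; rewrite (negPf x0).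
  have [c1|c1] := eqVneq c 1.
    have xE : x = n%:R * B.
      by apply/eqP; rewrite -subr_eq0 -affine_orbit1 -c1 xn.
    by right; exists n => //; rewrite -xE -cy c1 mul1r.
  have xE := (affine_orbit_eq0 x n c0 c1).1 xn.
  left; left; left; exists c.
    by move=> [/eqP|/eqP]; rewrite ?(negPf c0) ?(negPf c1).
  exists n => //; congr (_, _) => //.
  apply: (mulfI c0).
  by rewrite forbidden_pair_step // -xE.
- case=> [[[[c c01 [n _ [<- <-]]]|[/= -> _]]|[_ /= ->]]|[n _ [<- <-]]].
  + have c0 : c != 0 by apply/eqP => c0; apply: c01; left.
    have c1 : c != 1 by apply/eqP => c1; apply: c01; right.
    apply: (forbidden_affine (n := n) (forbidden_pair_step n c0 c1)).
    exact/affine_orbit_eq0.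
  + have [->|y0] := eqVneq y 0; first exact: forbidden_snd0.
    by apply: (forbidden_affine (c := B / y) (n := 0)); rewrite ?divfK ?add0r.
  + exact: forbidden_snd0.
  + apply: (forbidden_affine (c := 1) (n := n)); first by rewrite mul1r.
    by rewrite affine_orbit1 subrr.
Qed.

End AffineReduction.

Theorem theorem4 (R : realType) (B : R[i]) :
  let num (x y : R[i]) := x ^+ 2 + B * x - B * y in
  let den (x y : R[i]) := y in
  forbidden_set num den = S3 B /\
  forall z0 zm1 : R[i], ~ forbidden_set num den (z0, zm1) ->
    let C := (z0 + B) / zm1 in
    exists z : nat -> R[i],
      [/\ forall n : nat, iterate num den (z0, zm1) n = Some (z n),
          forall n : nat, z n.+1 = C * z n - B
        & forall n : nat, (1 <= n)%N ->
            z n = C ^+ n * z0 - \sum_(1 <= k < n.+1) C ^+ k.-1 * B].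
Proof.
move=> num den; split; first exact: forbidden_setE.
move=> x y nforb C.
have y0 : y != 0.
  by apply/eqP => y0; apply: nforb; rewrite y0; exact: (forbidden_snd0 B).
have cy : C * y = x + B by rewrite divfK.
exists (affine_orbit B C x); split=> [n|n|n _]; last exact: affine_orbit_sum.
- apply: iterate_affine => // k; apply/eqP => wk.
  by apply: nforb; apply/(forbiddenP cy); exists k.
- exact: affine_orbitS.
Qed.
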